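(* Let $T\ge1$, $n\ge2$, $\mu\in\mathbb{R}$, $\sigma>0$, $z^*\in\mathbb{R}$, $\tau\in\{1,\dots,T\}$. Under $\mathbf{H_0}$ the real numbers $X_{t,k}$ ($t\le T$, $k\le n$) are i.i.d. $\mathcal{N}(\mu,\sigma^2)$; under $\mathbf{H_1^\tau}$ they are generated the same way and then $X_{\tau,J}$ is replaced by $z^*$, with $J$ uniform on $\{1,\dots,n\}$ independent of the data. Let $\bar X_\tau=\frac1n\sum_{k=1}^nX_{\tau,k}$ and \[ \log\mathrm{LR}_\tau=-\frac12\log\Big(\frac{n-1}{n}\Big)-\frac{n}{2(n-1)\sigma^2}(\bar X_\tau-\mu)^2+\frac{(z^*-\mu)n}{(n-1)\sigma^2}(\bar X_\tau-\mu)-\frac{(z^*-\mu)^2}{2(n-1)\sigma^2}. \] For $\gamma\in\mathbb{R}$ let $\beta(\gamma)=\mathbb{P}_{\mathbf{H_1^\tau}}(\log\mathrm{LR}_\tau<\gamma)$. Define $\gamma_{\max}=\frac12\big[\frac{(z^*-\mu)^2}{\sigma^2}-\log\big(\frac{n-1}{n}\big)\big]$, $m^*=\frac{(z^*-\mu)^2}{\sigma^2}$, $a=\sqrt{m^*n}$ and $b(\gamma)=\sqrt{(n-1)\big(m^*-\log(1-\frac1n)-2\gamma\big)}$. Then for every $\gamma\le\gamma_{\max}$, \[ \beta(\gamma)=\Phi\Big(a\sqrt{\tfrac{n-1}{n}}-b(\gamma)\sqrt{\tfrac{n}{n-1}}\Big)+\Phi\Big(-a\sqrt{\tfrac{n-1}{n}}-b(\gamma)\sqrt{\tfrac{n}{n-1}}\Big),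 \] where $\Phi$ is the standard normal cumulative distribution function.
   Context: $\beta(\gamma)$ is the Type II error of the test that declares ''target present'' when $\log\mathrm{LR}_\tau\ge\gamma$. *)

(* Defs.v *)
From HB Require Import structures.
From mathcomp Require Import all_boot all_order all_algebra.
From mathcomp Require Import all_classical all_reals all_analysis.
Set Implicit Arguments. Unset Strict Implicit. Unset Printing Implicit Defensive.
Import Order.TTheory GRing.Theory Num.Theory.
Local Open Scope classical_set_scope.
Local Open Scope ring_scope.

Section defs.
Context {R : realType}.

Definition Phi (x : R) : R := fine (normal_prob 0 1 `]-oo, x]).

Definition rowmean (n : nat) (x : 'I_n -> R) : R :=
  (n%:R)^-1 * \sum_(k < n) x k.

Definition logLR (n : nat) (mu sigma zs xbar : R) : R :=
  - (1/2) * ln ((n%:R - 1) / n%:R)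
  - n%:R / (2 * (n%:R - 1) * sigma ^+ 2) * (xbar - mu) ^+ 2
  + (zs - mu) * n%:R / ((n%:R - 1) * sigma ^+ 2) * (xbar - mu)
  - (zs - mu) ^+ 2 / (2 * (n%:R - 1) * sigma ^+ 2).

Definition gamma_max (n : nat) (mu sigma zs : R) : R :=
  (1/2) * ((zs - mu) ^+ 2 / sigma ^+ 2 - ln ((n%:R - 1) / n%:R)).

Definition mstar (mu sigma zs : R) : R := (zs - mu) ^+ 2 / sigma ^+ 2.

Definition acoef (n : nat) (mu sigma zs : R) : R :=
  Num.sqrt (mstar mu sigma zs * n%:R).

Definition bcoef (n : nat) (mu sigma zs gamma : R) : R :=
  Num.sqrt ((n%:R - 1) * (mstar mu sigma zs - ln (1 - (n%:R)^-1) - 2 * gamma)).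

End defs.

Section model.
Context {R : realType} {d : measure_display} {Omega : measurableType d}.
Variable P : probability Omega R.

(** Hypothesis H_0 together with the auxiliary index J:
    the X t k (t < T, k < n) are i.i.d. N(mu, sigma^2), J is uniform on
    'I_n, and J is independent of the data.  Since there are finitely many
    variables, mutual independence is stated as the product rule for all
    rectangles (taking full sets gives all sub-families). *)
Definition H0_with_index (T n : nat) (X : 'I_T -> 'I_n -> Omega -> R)
    (J : Omega -> 'I_n) (mu sigma : R) : Prop :=
  [/\ (forall t k, measurable_fun setT (X t k)),
      (forall j : 'I_n, measurable (J @^-1` [set j])),
      (forall j : 'I_n, P (J @^-1` [set j]) = ((n%:R)^-1)%:E),
      (forall t k (B : set R), measurable B ->
          P (X t k @^-1` B) = normal_prob mu sigma B) &
      (forall (A : set 'I_n) (B : 'I_T -> 'I_n -> set R),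
          (forall t k, measurable (B t k)) ->
          P ([set w | A (J w)] `&` [set w | forall t k, B t k (X t k w)]) =
          (P [set w | A (J w)] *
             \prod_(t < T) \prod_(k < n) P (X t k @^-1` B t k))%E)].

Definition H1_data (T n : nat) (X : 'I_T -> 'I_n -> Omega -> R)
    (J : Omega -> 'I_n) (tau : 'I_T) (zs : R) (t : 'I_T) (k : 'I_n)
    (w : Omega) : R :=
  if (t == tau) && (k == J w) then zs else X t k w.

Definition beta (T n : nat) (X : 'I_T -> 'I_n -> Omega -> R)
    (J : Omega -> 'I_n) (tau : 'I_T) (mu sigma zs gamma : R) : \bar R :=
  P [set w | logLR n mu sigma zs
               (rowmean (fun k => H1_data X J tau zs tau k w)) < gamma].

End model.

(* Main.v *)
Require Import Defs.
From HB Require Import structures.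
From mathcomp Require Import all_boot all_order all_algebra.
From mathcomp Require Import all_classical all_reals all_analysis.
From mathcomp Require Import measurable_realfun ring lra.
Set Implicit Arguments.
Unset Strict Implicit.
Unset Printing Implicit Defensive.
Import Order.TTheory GRing.Theory Num.Theory.
Local Open Scope classical_set_scope.
Local Open Scope ring_scope.

(** Completing the square, [logLR] equals [gamma_max] minus a positive multiple
    of [(xbar - zs)^2], so the test accepts [H_0] exactly when the sample mean is
    far from [zs].  Given [J = j], the row sum is [zs] plus the sum of the [n - 1]
    remaining variables.  This sum is normal with mean [(n - 1) mu] and variance
    [(n - 1) sigma^2]: for two variables the convolution of the densities is
    computed by completing the square, and induction on the number of summands
    gives the general case.  The law does not depend on [j], so averaging over
    [J] changes nothing, and after standardisation the event is the union of the
    two tails [z < c - b] and [z > c + b] of a standard normal variable, with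
    [c = (zs - mu) sqrt (n - 1) / sigma] and [b = bcoef * sqrt (n / (n - 1))]. *)

(** * Affine changes of variable for Lebesgue measure *)

Section lebesgue_affine.
Context {R : realType}.
Local Notation leb := (@lebesgue_measure R).
Local Open Scope ereal_scope.

Lemma measurable_affine (s m : R) :
  measurable_fun [set: measurableTypeR R]
    (fun x : measurableTypeR R => (s * x + m)%R : measurableTypeR R).
Proof. by apply: measurable_funD => //; exact: measurable_funM. Qed.

(** Both sides are measures in [A] with the same value on half-open intervals, and these values
    determine Lebesgue measure. *)
Lemma lebesgue_measure_affine (s m : R) (A : set R) : (0 < s)%R ->
  measurable A ->
  leb A = s%:E * leb ((fun x => s * x + m)%R @^-1` A).
Proof.
move=> s0 mA.
pose phi (x : measurableTypeR R) : measurableTypeR R := (s * x + m)%R.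
have mphi : measurable_fun setT phi by exact: measurable_affine.
pose nu := mscale (NngNum (ltW s0))
  (measure_function_pushforward__canonical__measure_function_Measure leb mphi).
rewrite (@lebesgue_measure_unique R nu)// => X [[a b]] /= _ <-.
rewrite /nu /mscale/= /pushforward/=.
rewrite (_ : _ @^-1` _ = `]((a - m) / s)%R, ((b - m) / s)%R]%classic); last first.
  apply/seteqP; split => x /=; rewrite /phi !in_itv/=;
    by rewrite ltr_pdivrMr// ler_pdivlMr// ltrBlDr lerBrDr (mulrC x).
rewrite !lebesgue_measure_itv/= !lte_fin ltr_pM2r ?invr_gt0// ltrBlDr subrK.
case: ifP => _; last by rewrite mule0.
by rewrite -EFinM; congr EFin; field; rewrite gt_eqF.
Qed.

Lemma ge0_integral_affine (s m : R) (f : R -> \bar R) : (0 < s)%R ->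
  measurable_fun setT f -> (forall x, 0 <= f x) ->
  \int[leb]_x f x = s%:E * \int[leb]_x f (s * x + m)%R.
Proof.
move=> s0 mf f0.
pose phi (x : measurableTypeR R) : measurableTypeR R := (s * x + m)%R.
have mphi : measurable_fun setT phi by exact: measurable_affine.
pose nu := mscale (NngNum (ltW s0))
  (measure_function_pushforward__canonical__measure_function_Measure leb mphi).
rewrite (@eq_measure_integral _ _ _ _ nu); last first.
  by move=> A mA _; exact: lebesgue_measure_affine.
rewrite ge0_integral_mscale//; congr (_ * _).
by rewrite ge0_integral_pushforward.
Qed.

Lemma ge0_integral_opp (f : R -> \bar R) :
  measurable_fun setT f -> (forall x, 0 <= f x) ->
  \int[leb]_x f x = \int[leb]_x f (- x)%R.
Proof.
move=> mf f0.
transitivity (\int[pushforward leb (-%R : _ -> measurableTypeR R)]_x f x).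
  by apply: eq_measure_integral => //= A mA AS; exact/esym/lebesgue_measureN.
by rewrite ge0_integral_pushforward.
Qed.

End lebesgue_affine.

(** * Normal laws: densities, standardisation and symmetry *)

Section normal_affine.
Context {R : realType}.
Local Notation leb := (@lebesgue_measure R).
Local Open Scope ereal_scope.

Lemma measurable_EFin_normal_pdf (m s : R) :
  measurable_fun setT (fun x : R => (normal_pdf m s x)%:E).
Proof. by apply/measurable_EFinP; apply: measurable_normal_pdf. Qed.

(** The Radon-Nikodym derivative and [normal_pdf] have the same integral over every measurable set,
    so they agree almost everywhere. *)
Lemma ge0_integral_normal_prob (m s : R) (f : R -> \bar R) :
  measurable_fun setT f -> (forall x, 0 <= f x) ->
  \int[normal_prob m s]_x f x = \int[leb]_x (f x * (normal_pdf m s x)%:E).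
Proof.
move=> mf f0.
have dom := normal_prob_dominates m s.
rewrite -(Radon_Nikodym_SigmaFinite.change_of_variables dom)//.
have mpdf := measurable_EFin_normal_pdf m s.
have irn := Radon_Nikodym_SigmaFinite.f_integrable dom.
apply: ae_eq_integral => //.
- by apply: emeasurable_funM => //; exact: measurable_int irn.
- exact: emeasurable_funM.
- apply: ae_eqe_mul2l; apply: integral_ae_eq => // A _ mA.
  by rewrite -Radon_Nikodym_SigmaFinite.f_integral.
Qed.

Lemma normal_probE (m s : R) (A : set R) : measurable A ->
  normal_prob m s A = \int[leb]_x ((\1_A x)%:E * (normal_pdf m s x)%:E).
Proof.
move=> mA; rewrite -ge0_integral_normal_prob; last 2 first.
- by apply/measurable_EFinP; apply: measurable_indic.
- by move=> x; rewrite lee_fin.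
by rewrite integral_indic// setIT.
Qed.

Lemma normal_pdf_affine (m s x : R) : (0 < s)%R ->
  (s * normal_pdf m s (s * x + m) = normal_pdf 0 1 x)%R.
Proof.
move=> s0; rewrite !normal_pdfE ?gt_eqF//= mulrA; congr (_ * _)%R.
  rewrite /normal_peak expr1n mul1r -mulrnAr sqrtrM ?sqr_ge0//.
  by rewrite sqrtr_sqr gtr0_norm// invfM mulVKf// gt_eqF.
rewrite /normal_fun addrK subr0; congr expR.
by field; rewrite gt_eqF.
Qed.

Lemma normal_prob_affine (m s : R) (A : set R) : (0 < s)%R -> measurable A ->
  normal_prob m s A = normal_prob 0 1 ((fun x => s * x + m)%R @^-1` A).
Proof.
move=> s0 mA.
have mA' : measurable ((fun x : R => s * x + m)%R @^-1` A).
  by rewrite -[_ @^-1` _]setTI; exact: measurable_affine.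
have mpdf := measurable_EFin_normal_pdf m s.
rewrite !normal_probE// (ge0_integral_affine m s0); first last.
- by move=> x; rewrite mule_ge0// lee_fin ?normal_pdf_ge0.
- by apply: emeasurable_funM => //; exact/measurable_EFinP.
rewrite -ge0_integralZl//; last 3 first.
- apply: (measurableT_comp (f := fun x => (\1_A x)%:E * (normal_pdf m s x)%:E)).
    by apply: emeasurable_funM => //; exact/measurable_EFinP.
  exact: measurable_affine.
- by move=> x _; rewrite mule_ge0// lee_fin ?normal_pdf_ge0.
- by rewrite lee_fin ltW.
by apply: eq_integral => x _; rewrite -(normal_pdf_affine m _ s0) EFinM muleCA.
Qed.

Lemma normal_prob_opp (A : set R) : measurable A ->
  normal_prob 0 1 A = normal_prob 0 1 (-%R @^-1` A).
Proof.
move=> mA.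
have mA' : measurable ((-%R : R -> R) @^-1` A).
  by rewrite -[_ @^-1` _]setTI; exact: oppr_measurable.
have mpdf := measurable_EFin_normal_pdf 0 1.
rewrite !normal_probE// ge0_integral_opp; first last.
- by move=> x; rewrite mule_ge0// lee_fin ?normal_pdf_ge0.
- by apply: emeasurable_funM => //; exact/measurable_EFinP.
apply: eq_integral => x _; congr (_ * _%:E).
by rewrite !normal_pdfE ?oner_eq0//= /normal_fun !subr0 sqrrN.
Qed.

End normal_affine.

(** * Convolution of two normal laws *)

Section normal_convolution.
Context {R : realType}.
Local Notation leb := (@lebesgue_measure R).

Lemma normal_peak_inv (s : R) : 0 < s ->
  normal_peak s = (s * Num.sqrt (pi *+ 2))^-1.
Proof.
move=> s0; rewrite /normal_peak -mulrnAr sqrtrM ?sqr_ge0//.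
by rewrite sqrtr_sqr gtr0_norm.
Qed.

(* Completing the square in [x]: the product of the densities factors into the
   density of the sum at [z] and a normal density in [x]. *)
Lemma normal_pdf_mul (m1 s1 m2 s2 x z : R) : 0 < s1 -> 0 < s2 ->
  let s := Num.sqrt (s1 ^+ 2 + s2 ^+ 2) in
  normal_pdf m1 s1 x * normal_pdf m2 s2 (z - x) =
  normal_pdf (m1 + m2) s z *
    normal_pdf ((m1 * s2 ^+ 2 + (z - m2) * s1 ^+ 2) / s ^+ 2) (s1 * s2 / s) x.
Proof.
move=> s10 s20 s.
have q0 : 0 < s1 ^+ 2 + s2 ^+ 2 by rewrite addr_gt0// exprn_gt0.
have s0 : 0 < s by rewrite sqrtr_gt0.
have s2E : s ^+ 2 = s1 ^+ 2 + s2 ^+ 2 by rewrite sqr_sqrtr// ltW.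
have t0 : 0 < s1 * s2 / s by rewrite divr_gt0// mulr_gt0.
rewrite !normal_pdfE ?gt_eqF//= mulrACA [in RHS]mulrACA; congr (_ * _).
  rewrite !normal_peak_inv//.
  have p0 : Num.sqrt (pi *+ 2) != 0 :> R.
    by rewrite gt_eqF// sqrtr_gt0 pmulrn_lgt0// pi_gt0.
  by field; rewrite p0 !gt_eqF.
rewrite /normal_fun -!expRD; congr expR.
rewrite !expr_div_n s2E.
by field; rewrite !gt_eqF.
Qed.

Local Open Scope ereal_scope.

Lemma measurable_add_preimage (C : set R) : measurable C ->
  measurable [set p : measurableTypeR R * measurableTypeR R | C (p.1 + p.2)%R].
Proof.
move=> mC.
have : measurable_fun setT
    (fun p : measurableTypeR R * measurableTypeR R => (p.1 + p.2)%R).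
  by apply: measurable_funD.
by move=> /(_ measurableT _ mC); rewrite setTI.
Qed.

(** By Tonelli the integral over [x] can be taken first; after [normal_pdf_mul] only a normal
    density in [x] is left there, with integral 1. *)
Lemma normal_prob_add (m1 s1 m2 s2 : R) (C : set R) :
  (0 < s1)%R -> (0 < s2)%R -> measurable C ->
  (normal_prob m1 s1 \x normal_prob m2 s2) [set p | C (p.1 + p.2)%R] =
  normal_prob (m1 + m2)%R (Num.sqrt (s1 ^+ 2 + s2 ^+ 2)) C.
Proof.
move=> s10 s20 mC; set s := Num.sqrt _.
set D := [set p | _].
have mD := measurable_add_preimage mC; rewrite -/D in mD.
have mpdf m t := @measurable_EFin_normal_pdf R m t.
have mindic : measurable_fun setT (fun z : R => (\1_C z)%:E : \bar R).
  by apply/measurable_EFinP; apply: measurable_indic.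
pose f (x z : R) : \bar R :=
  (\1_C z)%:E * (normal_pdf m2 s2 (z - x))%:E * (normal_pdf m1 s1 x)%:E.
have f0 x z : 0 <= f x z.
  by rewrite !mule_ge0// lee_fin ?normal_pdf_ge0.
have mf : measurable_fun setT
    (fun p : measurableTypeR R * measurableTypeR R => f p.1 p.2).
  apply: emeasurable_funM; last exact: (measurableT_comp (mpdf m1 s1)).
  apply: emeasurable_funM; first exact: (measurableT_comp mindic).
  apply: (measurableT_comp (mpdf m2 s2)).
  exact: measurable_funB.
have mtr x : measurable_fun [set: measurableTypeR R]
    (fun z : measurableTypeR R => (z - x)%R : measurableTypeR R).
  exact: measurable_funB.
(* Substituting [z - x] turns the section of [D] at [x] into [C] itself and moves the shift into the
   density. *)
have secE x : normal_prob m2 s2 (xsection D x) =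
    \int[leb]_z ((\1_C z)%:E * (normal_pdf m2 s2 (z - x))%:E).
  have mDx : measurable (xsection D x) by exact: measurable_xsection.
  rewrite normal_probE// (@ge0_integral_affine _ 1 (- x)%R)//; last 2 first.
  - by apply: emeasurable_funM => //; apply/measurable_EFinP; apply: measurable_indic.
  - by move=> y; rewrite mule_ge0// lee_fin ?normal_pdf_ge0.
  rewrite mul1e; apply: eq_integral => z _; rewrite mul1r; congr (_%:E * _).
  rewrite !indicE; congr (nat_of_bool _)%:R.
  by apply/idP/idP; rewrite !inE /xsection/= ?inE /D/= subrKC.
rewrite /product_measure1/= ge0_integral_normal_prob//; last first.
  exact: measurable_fun_xsection.
transitivity (\int[leb]_x \int[leb]_z f x z).
  apply: eq_integral => x _; rewrite secE /f ge0_integralZr//.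
  - apply: emeasurable_funM => //; exact: (measurableT_comp (mpdf m2 s2) (mtr x)).
  - by move=> z _; rewrite mule_ge0// lee_fin ?normal_pdf_ge0.
  - by rewrite lee_fin normal_pdf_ge0.
transitivity (\int[leb]_z \int[leb]_x f x z).
  apply: (@fubini_tonelli _ _ _ _ _ leb leb (fun p => f p.1 p.2) mf).
  by move=> x; exact: f0.
rewrite normal_probE//; apply: eq_integral => z _.
transitivity (\int[leb]_x ((\1_C z)%:E * (normal_pdf (m1 + m2) s z)%:E *
   (normal_pdf ((m1 * s2 ^+ 2 + (z - m2) * s1 ^+ 2) / s ^+ 2)
      (s1 * s2 / s) x)%:E)).
  apply: eq_integral => x _; rewrite /f -!muleA -!EFinM -normal_pdf_mul//.
  by rewrite (mulrC (normal_pdf m2 _ _)).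
rewrite ge0_integralZl//; last 3 first.
- exact: mpdf.
- by move=> x _; rewrite lee_fin normal_pdf_ge0.
- by rewrite mule_ge0// lee_fin ?normal_pdf_ge0.
by rewrite integral_normal_pdf mule1.
Qed.

End normal_convolution.

(** * Sums of independent normal variables, relative to an event *)

Section sum_of_normals.
Context {R : realType} {d : measure_display} {Omega : measurableType d}.
Variable P : probability Omega R.
Local Open Scope ereal_scope.

(* Carrying the event [E] through the induction lets the events on the
   variables already split off be absorbed into [E]. *)
Lemma prob_sum_normal (I : eqType) (Y : I -> Omega -> R) (m s : R)
    (r : seq I) (E : set Omega) (C : set R) :
  (0 < s)%R -> (forall i, measurable_fun setT (Y i)) -> measurable E ->
  uniq r -> (0 < size r)%N -> measurable C ->
  (forall B : I -> set R, (forall i, measurable (B i)) ->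
    P (E `&` [set w | forall i, i \in r -> B i (Y i w)]) =
    P E * \prod_(i <- r) normal_prob m s (B i)) ->
  P (E `&` [set w | C (\sum_(i <- r) Y i w)%R]) =
  P E * normal_prob (m *+ size r)%R (s * Num.sqrt (size r)%:R)%R C.
Proof.
move=> s0 mY; elim: r E C => // i r IH E C mE /= /andP[ir ur] _ mC indep.
have mYi A : measurable A -> measurable (Y i @^-1` A).
  by move=> mA; rewrite -[_ @^-1` _]setTI; exact: mY.
(* The induction really starts at one variable: an empty sum would have variance 0, which
   [normal_prob_add] excludes. *)
have [r0|r0] := posnP (size r).
  have {r0 IH ir ur} r0 : r = [::] by exact: size0nil.
  rewrite r0 /= in indep *; rewrite sqrtr1 mulr1 mulr1n.
  have := indep (fun=> C) (fun=> mC); rewrite big_seq1 => <-.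
  congr (P (_ `&` _)); apply/seteqP; split => w /=; rewrite big_seq1.
    by move=> Cw j; rewrite inE => /eqP ->.
  by apply; rewrite inE.
pose S w := (\sum_(j <- r) Y j w)%R.
have mS : measurable_fun setT S by exact: measurable_sum.
(* Independence of [Y i] and the remaining sum [S] given [E], tested on rectangles. *)
have rect A B : measurable A -> measurable B ->
    P (E `&` [set w | A (Y i w) /\ B (S w)]) =
    P E * (normal_prob m s A *
           normal_prob (m *+ size r)%R (s * Num.sqrt (size r)%:R)%R B).
  move=> mA mB.
  have PEA : P (E `&` Y i @^-1` A) = P E * normal_prob m s A.
    (* Full sets in the other coordinates have probability 1, which isolates [Y i]. *)
    have := indep (fun j => if j == i then A else setT).
    rewrite big_cons eqxx big_seq big1; last first.
      move=> j jr; case: eqP => [ji|_]; last exact: probability_setT.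
      by rewrite -ji jr in ir.
    rewrite mule1 => <-; last by move=> j; case: ifP.
    congr (P (_ `&` _)); apply/seteqP; split => w /=.
      by move=> Aw j _; case: eqP => [->|].
    by move=> /(_ i); rewrite inE eqxx => /(_ isT).
  (* The induction hypothesis is used with [E] cut down by the event that [Y i] lies in [A]. *)
  rewrite muleA -PEA -IH//; last 2 first.
  - by apply: measurableI => //; exact: mYi.
  - move=> B' mB'; rewrite PEA -muleA.
    have := indep (fun j => if j == i then A else B' j).
    rewrite big_cons eqxx.
    under eq_big_seq.
      move=> j jr; rewrite (_ : j == i = false); last first.
        by apply/negbTE; apply: contraNneq ir => <-.
      over.
    move=> <-; last by move=> j; case: ifP.
    congr (P _); rewrite -setIA; congr (_ `&` _); apply/seteqP; split => w /=.
      move=> [Aw Bw] j; rewrite inE; case: eqP => [->//|_ /=]; exact: Bw.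
    move=> H; split; first by have := H i; rewrite inE eqxx; exact.
    move=> j jr; have := H j; rewrite inE jr orbT => /(_ isT).
    by case: eqP => // ji; rewrite -ji jr in ir.
  by rewrite -setIA.
have mCS : measurable [set w | C (\sum_(j <- i :: r) Y j w)%R].
  rewrite -[X in measurable X]setTI.
  exact: (measurable_sum (i :: r) mY).
(* A null [E] makes both sides 0; otherwise division by [P E] is possible. *)
have [PE0|PE0] := eqVneq (P E) 0.
  rewrite PE0 mul0e; apply/eqP; rewrite eq_le measure_ge0 andbT -PE0.
  apply: le_measure; last by move=> w [].
  - by rewrite inE; exact: measurableI.
  - by rewrite inE.
have PEfin : P E \is a fin_num by exact: fin_num_measure.
have PEgt0 : (0 < fine (P E))%R.
  by rewrite fine_gt0// lt0e PE0 measure_ge0/= ltey_eq PEfin.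
have k0 : (0 <= (fine (P E))^-1)%R by rewrite invr_ge0 ltW.
pose YS w : (measurableTypeR R * measurableTypeR R)%type := (Y i w, S w).
have mYS : measurable_fun setT YS by apply: (measurable_fun_pair (mY i) mS).
(* The conditional law of the pair ([Y i], [S]) given [E]. By [rect] it agrees with the product of
   two normal laws on rectangles, hence everywhere. *)
pose nu := mscale (NngNum k0)
  (measure_function_pushforward__canonical__measure_function_Measure
    (mrestr P mE) mYS).
have nuE X : nu X = (fine (P E))^-1%:E * P (E `&` [set w | X (Y i w, S w)]).
  by rewrite /nu /mscale /= /pushforward /mrestr setIC.
have PnuE X : P (E `&` [set w | X (Y i w, S w)]) = P E * nu X.
  by rewrite nuE -{1}(fineK PEfin) muleA -EFinM divff ?gt_eqF// mul1e.
have := normal_prob_add m (m *+ size r) s0 _ mC.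
move=> /(_ (s * Num.sqrt (size r)%:R)%R).
have -> : (Num.sqrt (s ^+ 2 + (s * Num.sqrt (size r)%:R) ^+ 2) =
    s * Num.sqrt (size r).+1%:R)%R.
  rewrite exprMn sqr_sqrtr// -{1}(mulr1 (s ^+ 2)%R) -mulrDr -natr1 addrC.
  by rewrite sqrtrM ?sqr_ge0// sqrtr_sqr gtr0_norm// addrC.
rewrite (mulrS m) => <-; last by rewrite mulr_gt0// sqrtr_gt0 ltr0n.
rewrite [X in _ = _ * X](_ : _ = nu [set p | C (p.1 + p.2)%R]); last first.
  apply: product_measure_unique.
  - move=> A B mA mB; rewrite [LHS]nuE.
    have := rect _ _ mA mB; rewrite -[P E]fineK// => ->.
    by rewrite muleA -EFinM mulVf ?gt_eqF// mul1e.
  - exact: measurable_add_preimage.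
rewrite -PnuE; congr (P (_ `&` _)); apply/seteqP.
by split => w /=; rewrite big_cons.
Qed.

End sum_of_normals.

(** * The acceptance region of H_0 as two tails *)

Section rejection_region.
Context {R : realType}.
Implicit Types (n : nat) (mu sigma zs gamma z : R).

(** Centring the square at [zs] leaves [n - 1] times [(zs - mu) ^+ 2 / (2 * (n - 1) * sigma ^+ 2)];
    the factor [n - 1] cancels, so the maximum over [xbar] is [gamma_max]. *)
Lemma logLR_square n mu sigma zs xbar : (2 <= n)%N -> 0 < sigma ->
  logLR n mu sigma zs xbar =
  gamma_max n mu sigma zs
  - n%:R / (2 * (n%:R - 1) * sigma ^+ 2) * (xbar - zs) ^+ 2.
Proof.
move=> n2 s0; have n1 : 0 < n%:R - 1 :> R by rewrite subr_gt0 ltr1n.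
rewrite /logLR /gamma_max; set l := ln _.
by field; rewrite !gt_eqF.
Qed.

(** The bound on [gamma] keeps the radicand nonnegative; on negative numbers [Num.sqrt] is 0 and
    squaring would not undo it. *)
Lemma bcoef_sqr n mu sigma zs gamma : (2 <= n)%N ->
  gamma <= gamma_max n mu sigma zs ->
  (bcoef n mu sigma zs gamma * Num.sqrt (n%:R / (n%:R - 1))) ^+ 2 =
  2 * n%:R * (gamma_max n mu sigma zs - gamma).
Proof.
move=> n2 hg; have n1 : 0 < n%:R - 1 :> R by rewrite subr_gt0 ltr1n.
have n0 : 0 < n%:R :> R by rewrite ltr0n (leq_trans _ n2).
have lnE : 1 - n%:R^-1 = (n%:R - 1) / n%:R :> R by field; rewrite gt_eqF.
have bE : mstar mu sigma zs - ln (1 - n%:R^-1) - 2 * gamma =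
    2 * (gamma_max n mu sigma zs - gamma).
  by rewrite lnE /mstar /gamma_max; lra.
rewrite /bcoef bE exprMn !sqr_sqrtr.
- by field; rewrite gt_eqF.
- by rewrite divr_ge0// ltW.
- by rewrite mulr_ge0 ?(ltW n1)// mulr_ge0// subr_ge0.
Qed.

(** Here [z] is the standardised sum of the [n - 1] untouched variables, and [c] is the value of [z]
    at which the sample mean equals [zs]. *)
Lemma logLR_lt n mu sigma zs gamma z : (2 <= n)%N -> 0 < sigma ->
  gamma <= gamma_max n mu sigma zs ->
  let c := (zs - mu) / sigma * Num.sqrt (n%:R - 1) in
  let b := bcoef n mu sigma zs gamma * Num.sqrt (n%:R / (n%:R - 1)) in
  (logLR n mu sigma zs (n%:R^-1 *
     (zs + (sigma * Num.sqrt (n%:R - 1) * z + mu * (n%:R - 1)))) < gamma) =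
  (z < c - b) || (c + b < z).
Proof.
move=> n2 s0 hg c b; have n1 : 0 < n%:R - 1 :> R by rewrite subr_gt0 ltr1n.
have n0 : 0 < n%:R :> R by rewrite ltr0n (leq_trans _ n2).
rewrite logLR_square//.
set q := Num.sqrt (n%:R - 1) in c *.
have q0 : 0 < q by rewrite sqrtr_gt0.
have q2 : q ^+ 2 = n%:R - 1 by rewrite sqr_sqrtr// ltW.
have -> : n%:R / (2 * (n%:R - 1) * sigma ^+ 2) * (n%:R^-1 *
     (zs + (sigma * q * z + mu * (n%:R - 1))) - zs) ^+ 2 =
    (z - c) ^+ 2 / (2 * n%:R).
  (* Eliminating [n] in favour of [q] makes the identity rational, free of square roots. *)
  rewrite /c -q2 (_ : n%:R = q ^+ 2 + 1); last by rewrite q2; ring.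
  by field; rewrite !gt_eqF// ?addr_gt0 ?exprn_gt0.
have b0 : 0 <= b by rewrite mulr_ge0 ?sqrtr_ge0.
have b2 := bcoef_sqr n2 hg; rewrite -/b in b2.
(* The inequality becomes [b ^+ 2 < (z - c) ^+ 2], and [0 <= b] allows taking square roots. *)
rewrite ltrBlDr -ltrBlDl ltr_pdivlMr ?mulr_gt0// mulrC -b2.
rewrite -[in LHS](real_normK (num_real (z - c))) ltr_sqr ?nnegrE//.
rewrite ltr_normr; lra.
Qed.

End rejection_region.

(** * Conditioning on the replaced index *)

Section beta_error.
Context {R : realType} {d : measure_display} {Omega : measurableType d}.
Variable P : probability Omega R.
Local Open Scope ereal_scope.

Lemma measurable_logLR_lt (n : nat) (mu sigma zs gamma : R) :
  (2 <= n)%N -> (0 < sigma)%R ->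
  measurable [set y : R | (logLR n mu sigma zs (n%:R^-1 * (zs + y)) < gamma)%R].
Proof.
move=> n2 s0.
have mf : measurable_fun setT
    (fun y : R => logLR n mu sigma zs (n%:R^-1 * (zs + y))%R).
  under eq_fun do rewrite logLR_square//.
  apply: measurable_funB => //; apply: measurable_funM => //.
  apply: measurable_funX; apply: measurable_funB => //.
  apply: measurable_funM => //; exact: measurable_funD.
have := mf measurableT _ (measurable_itv `]-oo, gamma[).
by rewrite setTI set_itvE.
Qed.

Lemma rowmean_H1_data (T n : nat) (X : 'I_T -> 'I_n -> Omega -> R)
    (J : Omega -> 'I_n) (tau : 'I_T) (zs : R) (w : Omega) :
  rowmean (fun k => H1_data X J tau zs tau k w) =
  (n%:R^-1 * (zs + \sum_(k <- enum (predC1 (J w))) X tau k w))%R.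
Proof.
rewrite /rowmean (bigD1 (J w))//= /H1_data !eqxx/=.
congr (_ * (_ + _))%R; rewrite big_enum/=.
by apply: eq_bigr => k /negbTE ->.
Qed.

(** Supplies the independence hypothesis of [prob_sum_normal] for the event that [J] equals [j]. *)
Lemma row_indep (T n : nat) (X : 'I_T -> 'I_n -> Omega -> R)
    (J : Omega -> 'I_n) (mu sigma : R) (tau : 'I_T) (j : 'I_n)
    (B : 'I_n -> set R) :
  H0_with_index P X J mu sigma -> (forall k, measurable (B k)) ->
  P (J @^-1` [set j] `&`
     [set w | forall k, k \in enum (predC1 j) -> B k (X tau k w)]) =
  P (J @^-1` [set j]) * \prod_(k <- enum (predC1 j)) normal_prob mu sigma (B k).
Proof.
move=> [mX mJ PJ PX indep] mB.
(* Full sets in the other rows and at the replaced entry [j] contribute factors 1. *)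
pose B' t k := if (t == tau) && (k != j) then B k else setT.
have := indep [set j] B'.
have mB' t k : measurable (B' t k) by rewrite /B'; case: ifP.
move=> /(_ mB') H.
transitivity (P ([set w | [set j] (J w)] `&`
    [set w | forall t k, B' t k (X t k w)])).
  congr (P (_ `&` _)); apply/seteqP; split => w /=.
    move=> Bw t k; rewrite /B'; case: ifP => // /andP[/eqP -> kj].
    by apply: Bw; rewrite mem_enum.
  by move=> Bw k; rewrite mem_enum inE => kj; have := Bw tau k; rewrite /B' eqxx kj.
rewrite H; congr (_ * _).
rewrite (bigD1 tau)//= [X in _ * X]big1 ?mule1; last first.
  move=> t /negbTE tt; apply: big1 => k _.
  by rewrite /B' tt/= preimage_setT probability_setT.
rewrite (bigD1 j)//= /B' eqxx/= eqxx/= preimage_setT probability_setT mul1e.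
rewrite big_enum/=; apply: eq_bigr => k /= kj.
by rewrite kj PX.
Qed.

Lemma beta_normal_prob (T n : nat) (X : 'I_T -> 'I_n -> Omega -> R)
    (J : Omega -> 'I_n) (mu sigma zs gamma : R) (tau : 'I_T) :
  (2 <= n)%N -> (0 < sigma)%R -> H0_with_index P X J mu sigma ->
  beta P X J tau mu sigma zs gamma =
  normal_prob (mu *+ n.-1)%R (sigma * Num.sqrt n.-1%:R)%R
    [set y | (logLR n mu sigma zs (n%:R^-1 * (zs + y)) < gamma)%R].
Proof.
move=> n2 s0 H; have [mX mJ PJ _ _] := H.
set C := [set y | _].
have mC : measurable C by exact: measurable_logLR_lt.
(* The pieces of the error event according to the value of [J]; they are disjoint. *)
pose F j := J @^-1` [set j] `&`
  [set w | C (\sum_(k <- enum (predC1 j)) X tau k w)%R].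
have mF j : measurable (F j).
  apply: measurableI; first exact: mJ.
  rewrite -[X in measurable X]setTI.
  exact: (measurable_sum (enum (predC1 j)) (mX tau)).
have -> : beta P X J tau mu sigma zs gamma =
    P (\big[setU/set0]_(j < n) F j).
  congr (P _); rewrite -bigcup_seq; apply/seteqP; split => w /=.
    rewrite rowmean_H1_data => Cw.
    by exists (J w) => //=; rewrite mem_index_enum.
  by move=> [j _ [/= <- Cw]]; rewrite rowmean_H1_data.
rewrite measure_bigsetU_ord//; last first.
  apply/trivIsetP => i j _ _ ij; apply/seteqP; split => w // [[/= Ji _] [/= Jj _]].
  by move: ij; rewrite -Ji -Jj eqxx.
have sz (j : 'I_n) : size (enum (predC1 j)) = n.-1 by rewrite -cardE cardC1 card_ord.
(* Whatever [j] is, [n - 1] variables remain, so the summands coincide and the weights add up to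
   1. *)
transitivity (\sum_(j < n) (n%:R^-1)%:E *
    normal_prob (mu *+ n.-1)%R (sigma * Num.sqrt n.-1%:R)%R C).
  apply: eq_bigr => j _.
  have r0 : (0 < size (enum (predC1 j)))%N.
    by rewrite sz -ltnS prednK// (leq_trans _ n2).
  rewrite -(PJ j) -(sz j); apply: prob_sum_normal => //.
  - exact: enum_uniq.
  - by move=> B mB; exact: row_indep H mB.
rewrite -ge0_sume_distrl => [|j _]; last by rewrite lee_fin invr_ge0.
rewrite sumEFin sumr_const card_ord -(mulr_natl n%:R^-1) divff ?mul1e//.
by rewrite pnatr_eq0 -lt0n (leq_trans _ n2).
Qed.

End beta_error.

(** * Tail probabilities of the standard normal law *)

Section standard_normal.
Context {R : realType}.
Local Open Scope ereal_scope.

(** Domination by Lebesgue measure excludes atoms, so strict and non-strict inequalities have the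
    same probability. *)
Lemma normal_prob_set1 (x : R) : normal_prob 0 1 [set x] = 0.
Proof.
have /null_content_dominatesP dom := @normal_prob_dominates R 0 1.
by apply: dom => //; exact: lebesgue_measure_set1.
Qed.

Lemma PhiE (x : R) : (Phi x)%:E = normal_prob 0 1 `]-oo, x].
Proof. by rewrite /Phi fineK// fin_num_measure. Qed.

Lemma normal_prob_lt (x : R) : normal_prob 0 1 `]-oo, x[ = (Phi x)%:E.
Proof.
rewrite PhiE -(@setUitv1 _ _ -oo%O x true)// measureU//.
  by rewrite [X in _ + X]normal_prob_set1 adde0.
by apply/seteqP; split => y //= [+ yx]; rewrite yx in_itv/= ltxx.
Qed.

Lemma normal_prob_gt (x : R) : normal_prob 0 1 `]x, +oo[ = (Phi (- x))%:E.
Proof.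
rewrite -normal_prob_lt normal_prob_opp//; congr (normal_prob 0 1 _).
by apply/seteqP; split => y /=; rewrite !in_itv/= andbT ltrNr.
Qed.

(** [0 <= b] makes the two tails disjoint, and reflection turns the right tail into a value of
    [Phi]. *)
Lemma normal_prob_tails (c b : R) : (0 <= b)%R ->
  normal_prob 0 1 [set z | (z < c - b)%R || (c + b < z)%R] =
  (Phi (c - b) + Phi (- c - b))%:E.
Proof.
move=> b0.
rewrite (_ : [set z | _] = `]-oo, (c - b)%R[ `|` `](c + b)%R, +oo[); last first.
  apply/seteqP; split => z /=; rewrite !in_itv/= andbT => /orP//.
rewrite measureU//; last first.
  apply/seteqP; split => z //=; rewrite !in_itv/= andbT => -[]; lra.
by rewrite [X in X + _]normal_prob_lt [X in _ + X]normal_prob_gt opprD EFinD.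
Qed.

End standard_normal.

(** * The formula for the Type II error *)

Theorem lemma3p6 (R : realType) (d : measure_display) (Omega : measurableType d)
    (P : probability Omega R) (T n : nat) (mu sigma zs : R) (tau : 'I_T)
    (X : 'I_T -> 'I_n -> Omega -> R) (J : Omega -> 'I_n) :
  (1 <= T)%N -> (2 <= n)%N -> 0 < sigma ->
  H0_with_index P X J mu sigma ->
  forall gamma : R, gamma <= gamma_max n mu sigma zs ->
  beta P X J tau mu sigma zs gamma =
  (Phi (acoef n mu sigma zs * Num.sqrt ((n%:R - 1) / n%:R)
        - bcoef n mu sigma zs gamma * Num.sqrt (n%:R / (n%:R - 1)))
   + Phi (- acoef n mu sigma zs * Num.sqrt ((n%:R - 1) / n%:R)
        - bcoef n mu sigma zs gamma * Num.sqrt (n%:R / (n%:R - 1))))%:E.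
Proof.
move=> _ n2 s0 H gamma hg; rewrite (beta_normal_prob _ _ _ n2 s0 H).
have n0 : 0 < n%:R :> R by rewrite ltr0n (leq_trans _ n2).
have n1E : n.-1%:R = n%:R - 1 :> R.
  by rewrite -subn1 natrB// (leq_trans _ n2).
have n1 : 0 < n%:R - 1 :> R by rewrite subr_gt0 ltr1n.
rewrite normal_prob_affine//; last 2 first.
- by rewrite mulr_gt0// sqrtr_gt0 n1E.
- exact: measurable_logLR_lt.
rewrite mulNr; set b := bcoef _ _ _ _ _ * _.
pose c := (zs - mu) / sigma * Num.sqrt (n%:R - 1).
(* The square root in [acoef] forgets the sign of [zs - mu], so only the absolute value of [c]
   appears. *)
have -> : acoef n mu sigma zs * Num.sqrt ((n%:R - 1) / n%:R) = `|c|.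
  rewrite /acoef -sqrtrM; last first.
    by rewrite mulr_ge0 ?(ltW n0)// /mstar divr_ge0 ?sqr_ge0.
  rewrite -sqrtr_sqr; congr Num.sqrt.
  rewrite /c exprMn sqr_sqrtr ?ltW// /mstar.
  by field; rewrite !gt_eqF.
have b0 : 0 <= b by rewrite mulr_ge0 ?sqrtr_ge0.
transitivity (normal_prob 0 1 [set z | (z < c - b) || (c + b < z)]).
  congr (normal_prob 0 1 _); apply/seteqP; split => z /=;
  by rewrite -(mulr_natr mu) n1E logLR_lt.
rewrite normal_prob_tails//; congr EFin.
(* A negative [c] merely exchanges the two [Phi] terms. *)
by case: (ger0P c) => _ //; rewrite opprK addrC.
Qed.
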